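(* Let $V$ and $H$ be Hilbert spaces, let $\mathfrak{a}\colon V\times V\to\mathbb{C}$ be a continuous accretive sesquilinear form and let $j\in\mathcal{L}(V,H)$ have dense range. Assume that $(\mathfrak{a},j)$ is associated with an m-accretive operator $A$. Denote by $S=(S_t)_{t>0}$ the $C_0$-semigroup on $H$ generated by $-A$. Let $C$ be a nonempty closed, convex subset of $H$, and let $P$ be the associated orthogonal projection onto $C$. Then the following statements are equivalent. (i) $S_tC\subset C$ for all $t>0$. (ii) For all $u\in D_j(\mathfrak{a})$ and every sequence $(w_k)_{k\in\mathbb{N}}$ in $V$ such that $\lim_{k\to\infty}j(w_k)=Pj(u)$ one has \[ \lim_{k\to\infty}\operatorname{Re}\mathfrak{a}(u,u-w_k)\ge 0 . \] (iii) For all $u\in D_j(\mathfrak{a})$ there exists a sequence $(w_k)_{k\in\mathbb{N}}$ in $D_j(\mathfrak{a})$ (or equivalently, in $V$) such that $\lim_{k\to\infty}j(w_k)=Pj(u)$ and \[ \limsup_{k\to\infty}\operatorname{Re}\mathfrak{a}(u,u-w_k)\ge 0 . \]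
   Context: Hilbert spaces are complex; inner products and sesquilinear forms are linear in the first and antilinear in the second argument. $\mathcal{L}(V,H)$ denotes the bounded linear operators from $V$ to $H$. The map $j$ is not assumed to be injective. A form $\mathfrak{a}$ on $V$ is accretive if $\operatorname{Re}\mathfrak{a}(u,u)\ge 0$ for all $u\in V$. An operator in $H$ is a linear map $A\colon D(A)\to H$ on a linear subspace $D(A)\subset H$. It is accretive if $\operatorname{Re}(Ax\mid x)_H\ge 0$ for all $x\in D(A)$, and m-accretive if in addition $I+A$ is surjective; $A$ is m-accretive if and only if $-A$ generates a $C_0$-semigroup of contractions on $H$. Define $D_j(\mathfrak{a})=\{u\in V : \text{there exists } f\in H \text{ such that } \mathfrak{a}(u,v)=(f\mid j(v))_H \text{ for all } v\in V\}$. The pair $(\mathfrak{a},j)$ is associated with the operator $A$ in $H$ if $D(A)=j(D_j(\mathfrak{a}))$ and $\mathfrak{a}(u,v)=(Aj(u)\mid j(v))_H$ for all $u\in D_j(\mathfrak{a})$ and $v\in V$; such an $A$ is unique if it exists. The orthogonal projection $P$ onto $C$ maps $x\in H$ to the unique element of $C$ nearest to $x$ (in general nonlinear). *)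

(* Defs.v *)
From HB Require Import structures.
From mathcomp Require Import all_boot all_order all_algebra.
From mathcomp Require Import complex.
From mathcomp Require Import all_classical all_reals all_analysis.

Set Implicit Arguments.
Unset Strict Implicit.
Unset Printing Implicit Defensive.

Import Order.TTheory GRing.Theory Num.Theory Num.Def.
Import numFieldNormedType.Exports.

Local Open Scope classical_set_scope.
Local Open Scope complex_scope.
Local Open Scope ring_scope.

(* [{dot H for conjC}] is linear in the first argument and conjugate-linear in
   the second. *)
HB.mixin Record CompleteNormedModule_isHilbert (R : realType) H
    of CompleteNormedModule R[i] H := {
  inner : {dot H for (@conjC R[i])} ;
  inner_normE : forall x : H, `|x| ^+ 2 = inner x x
}.

#[short(type="hilbertType")]
HB.structure Definition Hilbert (R : realType) :=
  {H of CompleteNormedModule R[i] H & CompleteNormedModule_isHilbert R H}.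

Definition accretive_form (R : realType) (V : hilbertType R)
    (a : V -> V -> R[i]) := forall u, 0 <= complex.Re (a u u).

(* The values of [op_fun] outside [op_dom] are irrelevant. *)
Record operator (R : realType) (H : hilbertType R) := Operator {
  op_dom : set H ;
  op_fun :> H -> H ;
  op_dom0 : op_dom 0 ;
  op_domP : forall (c : R[i]) x y,
    op_dom x -> op_dom y -> op_dom (c *: x + y) ;
  op_linear : forall (c : R[i]) x y,
    op_dom x -> op_dom y -> op_fun (c *: x + y) = c *: op_fun x + op_fun y
}.

Section operators.
Context (R : realType) (H : hilbertType R).
Implicit Types A B : operator H.

Lemma op_opp_linear A (c : R[i]) x y : op_dom A x -> op_dom A y ->
  - A (c *: x + y) = c *: (- A x) + - A y.
Proof. by move=> Ax Ay; rewrite op_linear// opprD scalerN. Qed.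

Definition op_opp A : operator H :=
  Operator (op_dom0 A) (@op_domP _ _ A) (@op_opp_linear A).

Definition accretive A :=
  forall x, op_dom A x -> 0 <= complex.Re (inner (A x) x).

Definition m_accretive A :=
  accretive A /\ forall y, exists2 x, op_dom A x & x + A x = y.

(* Indexed by t > 0: the values of [S] at t <= 0 are irrelevant. *)
Record C0_semigroup (S : R -> H -> H) : Prop := {
  C0_linear : forall t, 0 < t -> linear (S t) ;
  C0_continuous : forall t, 0 < t -> continuous (S t) ;
  C0_add : forall s t, 0 < s -> 0 < t -> S (s + t) = S s \o S t ;
  C0_cvg : forall x, S t x @[t --> 0^'+] --> x
}.

Definition diff_quotient (S : R -> H -> H) (x : H) (t : R) : H :=
  (t^-1)%:C *: (S t x - x).

Definition generates B (S : R -> H -> H) :=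
  op_dom B = [set x | cvg (diff_quotient S x t @[t --> 0^'+])] /\
  forall x, op_dom B x -> diff_quotient S x t @[t --> 0^'+] --> B x.

Definition is_projection (C : set H) (P : H -> H) :=
  forall x, C (P x) /\ forall y, C y -> `|x - P x| <= `|x - y|.

End operators.

Section association.
Context (R : realType) (V H : hilbertType R).
Variables (a : V -> V -> R[i]) (j : V -> H).

Definition form_dom : set V :=
  [set u | exists f : H, forall v, a u v = inner f (j v)].

Definition associated (A : operator H) :=
  op_dom A = j @` form_dom /\
  forall u v, form_dom u -> a u v = inner (A (j u)) (j v).

End association.

(* Main.v *)
Require Import Defs.
From HB Require Import structures.
From mathcomp Require Import all_boot all_order all_algebra.
From mathcomp Require Import complex.
From mathcomp Require Import all_classical all_reals all_analysis.
From mathcomp Require Import ring lra.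

(** Writing [x = j u], one has [a u (u - w k) = (A x | x - j (w k))], so all the
    conditions on sequences say that [Re (A x | x - P x) >= 0] for all [x] in
    the domain of [A]. If [C] is invariant, then
    [Re (S_t x - x | x - P x) <= 0] because [S_t] is a contraction and
    [S_t (P x)] lies in [C]; divide by [t]. Conversely, the condition makes the
    upper right Dini derivative of [t |-> dist(S_t x, C)^2] nonpositive for [x]
    in the domain of [A], hence [dist(S_t x, C) <= dist(x, C)], and this extends
    to all [x] because the domain of an m-accretive operator is dense.
    Contractivity of [S_t] is the case [C = {0}]. *)

Import Order.TTheory GRing.Theory Num.Theory Num.Def.
Import numFieldNormedType.Exports.

Local Open Scope classical_set_scope.
Local Open Scope ring_scope.

Set Implicit Arguments.
Unset Strict Implicit.

(** * Real inner product and real-valued norm of a complex Hilbert space *)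

Section real_inner_product.
Context {R : realType} {H : hilbertType R}.
Implicit Types (x y z : H) (c : R).
Local Open Scope complex_scope.

(** Norms and inner products take values in [R[i]], which is only partially ordered; the real parts
    allow ordinary real inequalities. *)
Definition rdot x y : R := complex.Re (inner x y).
Definition rnorm x : R := complex.Re `|x|.

Lemma rnormE x : `|x| = (rnorm x)%:C.
Proof. by rewrite /rnorm RRe_real// ger0_real. Qed.

Lemma rnorm_ge0 x : 0 <= rnorm x.
Proof. by rewrite -lecR -rnormE rmorph0. Qed.

Lemma rdotDl x y z : rdot (x + y) z = rdot x z + rdot y z.
Proof. by rewrite /rdot linearDl raddfD. Qed.

Lemma rdotDr x y z : rdot x (y + z) = rdot x y + rdot x z.
Proof. by rewrite /rdot linearDr raddfD. Qed.

Lemma rdotNl x y : rdot (- x) y = - rdot x y.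
Proof. by rewrite /rdot linearNl raddfN. Qed.

Lemma rdotNr x y : rdot x (- y) = - rdot x y.
Proof. by rewrite /rdot linearNr raddfN. Qed.

Lemma rdotC x y : rdot x y = rdot y x.
Proof.
rewrite /rdot (hermC inner x y) expr0 mul1r.
by apply: complexI; rewrite !complexRe Re_conj.
Qed.

Lemma rdotZl c x y : rdot (c%:C *: x) y = c * rdot x y.
Proof.
rewrite /rdot linearZl_LR /=.
by case: (inner x y) => a b /=; rewrite mul0r subr0.
Qed.

Lemma rdotZr c x y : rdot x (c%:C *: y) = c * rdot x y.
Proof. by rewrite rdotC rdotZl rdotC. Qed.

Lemma sqr_rnorm x : rnorm x ^+ 2 = rdot x x.
Proof.
by rewrite /rdot -inner_normE rnormE -rmorphXn.
Qed.

Lemma rnorm_sqrD x y :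
  rnorm (x + y) ^+ 2 = rnorm x ^+ 2 + 2 * rdot x y + rnorm y ^+ 2.
Proof.
by rewrite !sqr_rnorm rdotDl !rdotDr (rdotC y x); ring.
Qed.

Lemma rnormN x : rnorm (- x) = rnorm x.
Proof. by rewrite /rnorm normrN. Qed.

Lemma rnorm_distC x y : rnorm (x - y) = rnorm (y - x).
Proof. by rewrite /rnorm distrC. Qed.

Lemma rnorm_sqrB x y :
  rnorm (x - y) ^+ 2 = rnorm x ^+ 2 - 2 * rdot x y + rnorm y ^+ 2.
Proof. by rewrite rnorm_sqrD rnormN rdotNr; ring. Qed.

Lemma rnormD x y : rnorm (x + y) <= rnorm x + rnorm y.
Proof. by rewrite -lecR rmorphD /= -!rnormE ler_normD. Qed.

Lemma rnorm_distD z x y : rnorm (x - y) <= rnorm (x - z) + rnorm (z - y).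
Proof. by rewrite (le_trans _ (rnormD _ _))// addrA subrK. Qed.

Lemma rnormZ c x : rnorm (c%:C *: x) = `|c| * rnorm x.
Proof.
rewrite /rnorm normrZ; rewrite rnormE.
by rewrite normc_def /= expr0n addr0 sqrtr_sqr mul0r subr0.
Qed.

Lemma rnorm0 : rnorm 0 = 0.
Proof. by rewrite /rnorm normr0. Qed.

Lemma rnorm_eq0 x : rnorm x = 0 -> x = 0.
Proof. by move=> x0; apply/normr0_eq0; rewrite rnormE x0. Qed.

Lemma rnorm_gt0 x : (0 < rnorm x) = (x != 0).
Proof. by rewrite -ltcR -rnormE rmorph0 normr_gt0. Qed.

(** Cauchy-Schwarz is read off from the squared triangle inequality, since the norm is already
    given. *)
Lemma rdot_le x y : rdot x y <= rnorm x * rnorm y.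
Proof.
have := rnormD x y.
rewrite -(@ler_pXn2r _ 2)// ?nnegrE ?addr_ge0 ?rnorm_ge0//.
by rewrite rnorm_sqrD sqrrD -mulr_natl; lra.
Qed.

Lemma rdot_abs_le x y : `|rdot x y| <= rnorm x * rnorm y.
Proof.
rewrite ler_norml rdot_le andbT lerNl -rdotNl.
by rewrite (le_trans (rdot_le _ _))// rnormN.
Qed.

(** Positive elements of [R[i]] are real, so real radii [e] suffice. *)
Lemma cvg_rnormP T (F : set_system T) {FF : Filter F} (f : T -> H) l :
  f t @[t --> F] --> l <->
  forall e : R, 0 < e -> \forall t \near F, rnorm (l - f t) < e.
Proof.
rewrite cvgrPdist_lt; split=> [h e e0|h e e0].
  have /h : 0 < e%:C :> R[i] by rewrite ltcR.
  by apply: filterS => t; rewrite rnormE ltcR.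
have er : e = (complex.Re e)%:C by rewrite RRe_real// gtr0_real.
move: e0; rewrite er ltcR => /h.
by apply: filterS => t; rewrite rnormE ltcR.
Qed.

Lemma cvg_rdot T (F : set_system T) {FF : Filter F} (f g : T -> H) k l :
  f t @[t --> F] --> k -> g t @[t --> F] --> l ->
  rdot (f t) (g t) @[t --> F] --> rdot k l.
Proof.
move=> /cvg_rnormP fk /cvg_rnormP gl; apply/cvgrPdist_lt => e e0.
(* [M] dominates [rnorm l] and, once [rnorm (k - f t) < 1], also [rnorm (f t)]: the two factors left
   over when the difference of products is split. *)
pose M := 1 + rnorm k + rnorm l.
have M0 : 0 < M by rewrite /M -addrA ltr_wpDr ?addr_ge0 ?rnorm_ge0.
near=> t.
have f1 : rnorm (k - f t) < minr 1 (e / (2 * M)).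
  near: t; apply: fk; rewrite lt_min ltr01/= divr_gt0// mulr_gt0//.
have g1 : rnorm (l - g t) < e / (2 * M).
  by near: t; apply: gl; rewrite divr_gt0// mulr_gt0.
move: f1; rewrite lt_min => /andP[f1 f2].
have -> : rdot k l - rdot (f t) (g t) =
    rdot (k - f t) l + rdot (f t) (l - g t).
  by rewrite rdotDl rdotDr rdotNl rdotNr; ring.
have ft : rnorm (f t) <= 1 + rnorm k.
  have := rnormD (f t - k) k; rewrite subrK rnorm_distC => /le_trans; apply.
  by rewrite lerD2r ltW.
rewrite (le_lt_trans (ler_normD _ _))//.
rewrite (le_lt_trans (lerD (rdot_abs_le _ _) (rdot_abs_le _ _)))//.
have := rnorm_ge0 k; have := rnorm_ge0 l; have := rnorm_ge0 (k - f t).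
have := rnorm_ge0 (l - g t); have := rnorm_ge0 (f t) => f0 g0 h0 l0 k0.
have -> : e = M * (e / (2 * M)) + M * (e / (2 * M)).
  by field; rewrite lt0r_neq0.
apply: ler_ltD.
  rewrite mulrC ler_pM//; last exact: ltW.
  by rewrite /M; lra.
apply: (@le_lt_trans _ _ ((1 + rnorm k) * rnorm (l - g t))).
  by rewrite ler_wpM2r.
rewrite (@le_lt_trans _ _ (M * rnorm (l - g t)))//.
  by rewrite ler_wpM2r// /M; lra.
by rewrite ltr_pM2l.
Unshelve. all: by end_near. Qed.

Lemma cvg_rnorm T (F : set_system T) {FF : Filter F} (f : T -> H) l :
  f t @[t --> F] --> l -> rnorm (f t) @[t --> F] --> rnorm l.
Proof.
move=> /cvg_rnormP fl; apply/cvgrPdist_lt => e /fl.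
apply: filterS => t; apply: le_lt_trans; rewrite ler_norml.
have := rnorm_distD (f t) l 0; have := rnorm_distD l (f t) 0.
by rewrite !subr0 (rnorm_distC (f t) l); lra.
Qed.

Lemma rnorm_cauchy_cvg (f : nat -> H) :
  (forall e : R, 0 < e -> exists N, forall m n, (N <= m)%N -> (N <= n)%N ->
    rnorm (f m - f n) < e) -> cvg (f @ \oo).
Proof.
move=> h; apply: cauchy_cvg; apply: cauchy_exP => e e0.
have er : e = (complex.Re e)%:C by rewrite RRe_real// gtr0_real.
move: e0; rewrite er ltcR => /h[N hN].
exists (f N); exists N => // n /= Nn.
by rewrite -ball_normE /ball_ /= rnormE ltcR hN.
Qed.

End real_inner_product.

(** * Projections onto convex sets, and density of the domain *)

Section projection.
Context {R : realType} {H : hilbertType R}.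
Implicit Types (x y z : H).
Local Open Scope complex_scope.

Lemma convex_set_segment (C : set H) (c : R) x y : convex_set C ->
  0 <= c <= 1 -> C x -> C y -> C (x + c%:C *: (y - x)).
Proof.
move=> cC /andP[c0 c1] Cx Cy.
have c0' : (0 : R[i]) <= c%:C by rewrite lecR.
have c1' : c%:C <= (1 : R[i]) by rewrite lecR.
have := cC y x (Itv01 c0' c1') (mem_set Cy) (mem_set Cx).
rewrite inE; congr C.
rewrite /conv/= scalerBl scale1r scalerBr addrC -!addrA.
by congr (_ + _); rewrite addrC.
Qed.

(** Moving from [P x] towards [y] by a fraction [c] stays in [C] and changes the squared distance to
    [x] by [c ^ 2 * q - 2 * c * r], which is negative for small [c] if [r > 0]. *)
Lemma projection_obtuse (C : set H) (P : H -> H) x y :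
  convex_set C -> is_projection C P -> C y -> rdot (y - P x) (x - P x) <= 0.
Proof.
move=> cC PC Cy; have [CPx Pmin] := PC x.
set r := rdot _ _; rewrite leNgt; apply/negP => r0.
pose q := rnorm (y - P x) ^+ 2.
have q0 : 0 <= q by rewrite sqr_ge0.
pose c := minr 1 (r / (q + 1)).
have c0 : 0 < c by rewrite lt_min ltr01 divr_gt0// ltr_wpDl.
have c1 : c <= 1 by rewrite ge_min lexx.
have cr : c * (q + 1) <= r.
  by rewrite -ler_pdivlMr ?ltr_wpDl// ge_min lexx orbT.
have := Pmin _ (@convex_set_segment C c _ _ cC _ CPx Cy).
rewrite c1 ltW// => /(_ isT).
rewrite !rnormE lecR -(@ler_pXn2r _ 2)// ?nnegrE ?rnorm_ge0//.
rewrite opprD addrA [leRHS]rnorm_sqrB rdotZr rnormZ exprMn.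
rewrite real_normK ?num_real// rdotC -/r -/q.
have : c * (c * q) <= c * r by rewrite ler_pM2l//; nra.
have : 0 < c * r by rewrite mulr_gt0.
nra.
Qed.

(** The distance to [C] is 1-Lipschitz, because [P y] competes with [P x]. *)
Lemma projection_dist (C : set H) (P : H -> H) x y : is_projection C P ->
  rnorm (x - P x) <= rnorm (x - y) + rnorm (y - P y).
Proof.
move=> PC; apply: le_trans (rnorm_distD _ _ _).
by rewrite -lecR -!rnormE; apply: (PC x).2; apply: (PC y).1.
Qed.

(** A minimising sequence in the domain converges to some [z], a best approximation of [y].
    Surjectivity of [I + A] writes [y - z] as [x0 + A x0], and accretivity then forces [x0 = 0], so
    [y = z]. *)
Lemma m_accretive_dense (A : operator H) : m_accretive A ->
  forall y (e : R), 0 < e -> exists2 x, op_dom A x & rnorm (y - x) < e.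
Proof.
move=> [accA surA] y.
pose E := [set rnorm (y - x) ^+ 2 | x in op_dom A].
have E0 : has_inf E.
  split; first by exists (rnorm (y - 0) ^+ 2), 0 => //; exact: op_dom0.
  by exists 0 => _ [x _ <-]; exact: sqr_ge0.
have hd x : op_dom A x -> inf E <= rnorm (y - x) ^+ 2.
  by move=> Dx; apply: (inf_lbound E0.2); exists x.
have /choice[u uP] n : exists x,
    op_dom A x /\ rnorm (y - x) ^+ 2 < inf E + n.+1%:R^-1.
  have [|_ [x Dx <-] xn] := @inf_adherent _ E n.+1%:R^-1 _ E0; last by exists x.
  by rewrite invr_gt0.
have cu : cvg (u @ \oo).
  apply: rnorm_cauchy_cvg => e e0.
  have [N Ne] : exists N, 4 * N.+1%:R^-1 < e ^+ 2.
    exists (truncn (4 / e ^+ 2)); rewrite ltr_pdivrMr ?ltr0n// mulrC.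
    by rewrite -ltr_pdivrMr ?exprn_gt0// truncnS_gt.
  exists N => m n Nm Nn.
  rewrite -(@ltr_pXn2r _ 2)// ?nnegrE ?rnorm_ge0 ?ltW//.
  apply: le_lt_trans Ne.
  have [Dm um] := uP m; have [Dn un] := uP n.
  have hN k : (N <= k)%N -> k.+1%:R^-1 <= N.+1%:R^-1 :> R.
    by move=> Nk; rewrite lef_pV2 ?posrE ?ltr0n// ler_nat.
  have := hN _ Nm; have := hN _ Nn.
  (* The midpoint lies in the domain, so its squared distance to [y] is at least [inf E]. The
     parallelogram identity then bounds the squared distance of [u m] and [u n] by
     [2 / m.+1 + 2 / n.+1]. *)
  have /hd : op_dom A ((2^-1)%:C *: (u m + u n)).
    rewrite -[_ *: _]addr0; apply: op_domP; last exact: op_dom0.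
    by rewrite -[u m]scale1r; exact: op_domP.
  have -> : y - (2^-1)%:C *: (u m + u n) =
      (2^-1)%:C *: ((y - u m) + (y - u n)).
    rewrite addrACA -opprD scalerBr -[y + y]mulr2n -[y *+ 2](scaler_nat 2 y) scalerA.
    suff -> : (2^-1)%:C * 2%:R = 1 :> R[i] by rewrite scale1r.
    by rewrite -(rmorph_nat (@real_complex R)) -rmorphM/= mulVf.
  rewrite rnormZ exprMn ger0_norm//.
  have -> : u m - u n = (y - u n) - (y - u m).
    by rewrite opprB [RHS]addrC addrA subrK.
  rewrite (rnorm_sqrB (y - u n)) (rnorm_sqrD (y - u m)) (rdotC (y - u m)).
  rewrite exprVn; move: um un.
  set a := _.+1%:R^-1; set b := _.+1%:R^-1; set c := _.+1%:R^-1.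
  lra.
have [z uz] := (cvg_ex _).1 cu.
have [x0 Dx0 xz] := surA (y - z).
(* Since [y - z] is orthogonal to the domain, [x0] vanishes; comparing [z] with
   [z + x0] is already enough. *)
have r0 : 2 * rdot (y - z) x0 - rnorm x0 ^+ 2 <= 0.
  apply: (@ler_cvg_to nat \oo _ R (fun n => 2 * rdot (y - u n) x0 - rnorm x0 ^+ 2)
    (fun n => n.+1%:R^-1)).
  - apply: cvgB; last exact: cvg_cst.
    apply: cvgM; first exact: cvg_cst.
    apply: cvg_rdot; last exact: cvg_cst.
    by apply: cvgB => //; exact: cvg_cst.
  - exact: cvg_harmonic.
  - apply: nearW => n; have [Dn un] := uP n.
    have := hd (u n + x0).
    rewrite -[u n]scale1r => /(_ (op_domP _ Dn Dx0)).
    by rewrite scale1r opprD addrA rnorm_sqrB; move: un; set a := _^-1; lra.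
(* Inserting [y - z = x0 + A x0] into [r0] leaves [rnorm x0 ^+ 2 + 2 * rdot (A x0) x0 <= 0]. *)
have x00 : x0 = 0.
  apply: rnorm_eq0; apply/eqP; rewrite -sqrf_eq0 eq_le sqr_ge0 andbT.
  move: r0; rewrite -xz rdotDl -sqr_rnorm.
  by have := accA _ Dx0; rewrite -/(rdot _ _); lra.
have {xz} yz : y = z.
  have A0 : A 0 = 0.
    have := @op_linear _ _ A 1 0 0 (op_dom0 A) (op_dom0 A).
    rewrite scaler0 addr0 scale1r => /eqP.
    by rewrite -subr_eq0 opprD addrA subrr sub0r oppr_eq0 => /eqP.
  by apply/eqP; rewrite -subr_eq0 -xz x00 add0r A0.
move: uz; rewrite -yz => /cvg_rnormP uz e /uz [N _ /(_ N (leqnn N)) uN].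
by exists (u N) => //; exact: (uP N).1.
Qed.

End projection.

(** * Local boundedness of a semigroup near time 0 *)

Section uniform_boundedness.
Context {R : realType} {H : hilbertType R}.
Implicit Types (x y z : H) (f : H -> H).
Local Open Scope complex_scope.

Lemma nbhs_rnormP x (Q : set H) :
  nbhs x Q -> exists2 r : R, 0 < r & forall y, rnorm (x - y) < r -> Q y.
Proof.
move=> /nbhs_normP[e e0 eQ].
have er : e = (complex.Re e)%:C by rewrite RRe_real// gtr0_real.
exists (complex.Re e); first by rewrite -ltcR -er.
by move=> y xy; apply: eQ; rewrite /= rnormE er ltcR.
Qed.

Lemma near_0rightP (Q : set R) : (\forall t \near 0^'+, Q t) ->
  exists2 d : R, 0 < d & forall t, 0 < t -> t < d -> Q t.
Proof.
move=> /nbhs_ballP[d d0 dQ]; exists d => // t t0 td.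
by apply: dQ => //; rewrite /ball /= sub0r normrN gtr0_norm.
Qed.

Lemma continuous_rnorm f x (e : R) : continuous f -> 0 < e ->
  exists2 r : R, 0 < r & forall y, rnorm (x - y) < r -> rnorm (f x - f y) < e.
Proof.
by move=> cf e0; apply: nbhs_rnormP; move/cvg_rnormP: (cf x); exact.
Qed.

Lemma prop_linear0 f : linear f -> f 0 = 0.
Proof.
move=> lf; have := lf 1 0 0; rewrite scaler0 addr0 scale1r => /eqP.
by rewrite -subr_eq0 opprD addrA subrr sub0r oppr_eq0 => /eqP.
Qed.

Lemma prop_linearD f x y : linear f -> f (x + y) = f x + f y.
Proof. by move=> lf; have := lf 1 x y; rewrite !scale1r. Qed.

Lemma prop_linearZ f (c : R[i]) x : linear f -> f (c *: x) = c *: f x.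
Proof. by move=> lf; have := lf c x 0; rewrite !addr0 prop_linear0// addr0. Qed.

Lemma prop_linearB f x y : linear f -> f (x - y) = f x - f y.
Proof. by move=> lf; rewrite prop_linearD// -scaleN1r prop_linearZ// scaleN1r. Qed.

Lemma rnorm_scale_to x (r : R) : 0 <= r -> x != 0 ->
  rnorm ((r / rnorm x)%:C *: x) = r.
Proof.
move=> r0 x0; have nx : rnorm x != 0 by rewrite lt0r_neq0 ?rnorm_gt0.
by rewrite rnormZ ger0_norm ?divr_ge0 ?rnorm_ge0// divfK.
Qed.

(** Continuity at 0 bounds [f] by 1 on a ball of radius [r]; rescaling [x] to norm [r / 2] gives the
    constant [2 / r]. *)
Lemma continuous_linear_rnorm_bounded f : linear f -> continuous f ->
  exists2 K : R, 0 <= K & forall x, rnorm (f x) <= K * rnorm x.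
Proof.
move=> lf cf; have [r r0 hr] := @continuous_rnorm f 0 1 cf ltr01.
exists (2 / r) => [|x]; first by rewrite divr_ge0// ltW.
have [->|x0] := eqVneq x 0; first by rewrite prop_linear0// rnorm0 mulr0.
have r20 : 0 <= r / 2 by rewrite divr_ge0// ltW.
have nx : 0 < rnorm x by rewrite rnorm_gt0.
have := hr ((r / 2 / rnorm x)%:C *: x).
rewrite prop_linear0// !sub0r !rnormN rnorm_scale_to// prop_linearZ// rnormZ.
rewrite ger0_norm ?(divr_ge0 r20 (rnorm_ge0 x))// => h.
have {}h : r / 2 / rnorm x * rnorm (f x) < 1 by apply: h; lra.
have -> : rnorm (f x) = 2 / r * rnorm x * (r / 2 / rnorm x * rnorm (f x)).
  by field; rewrite !lt0r_neq0.
by rewrite ler_piMr ?(ltW h)// mulr_ge0 ?divr_ge0// ltW.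
Qed.

(** Since [2 f y = f (x + y) - f (x - y)], the two values cannot both be smaller than [f y]. This
    makes [f] large near an arbitrary centre [x]. *)
Lemma two_sided_large f x y : linear f ->
  rnorm (f y) <= rnorm (f (x + y)) \/ rnorm (f y) <= rnorm (f (x - y)).
Proof.
move=> lf; rewrite prop_linearD// prop_linearB//.
have := rnorm_distD 0 (f x + f y) (f x - f y).
have -> : f x + f y - (f x - f y) = (2%:R : R)%:C *: f y.
  by rewrite opprB addrC addrA subrK -mulr2n -(scaler_nat 2 (f y)) rmorph_nat.
rewrite rnormZ subr0 sub0r rnormN ger0_norm//.
case: (leP (rnorm (f y)) (rnorm (f x + f y))); first by left.
by move=> h1 h2; right; lra.
Qed.

(* The uniform boundedness principle by nested balls; the library version is
   restricted to real scalars. *)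
Lemma semigroup_locally_bounded (S : R -> H -> H) : C0_semigroup S ->
  exists M d : R, 0 < d /\
    forall t, 0 < t -> t < d -> forall x, rnorm (S t x) <= M * rnorm x.
Proof.
move=> [linS contS _ cvgS]; apply: contrapT => unb.
have large (M d : R) : 0 < d -> exists t x,
    [/\ 0 < t, t < d & M * rnorm x < rnorm (S t x)].
  move=> d0; apply: contrapT => h; apply: unb; exists M, d; split=> // t t0 td x.
  by rewrite leNgt; apply/negP => tx; apply: h; exists t, x.
(* A pair is a closed ball (centre, radius). The ball [b'] lies inside [b], and [S t] has norm at
   least [n] throughout [b']. *)
pose P n (b : H * R) (b' : H * R) (t : R) :=
  [/\ 0 < b'.2, b'.2 <= n.+1%:R^-1, 0 < t, t < n.+1%:R^-1 &
      forall y, rnorm (b'.1 - y) <= b'.2 ->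
        rnorm (b.1 - y) <= b.2 /\ n%:R <= rnorm (S t y)].
have step (q : nat * (H * R)) :
    exists c : (H * R) * R, 0 < q.2.2 -> P q.1 q.2 c.1 c.2.
  case: q => n [x r] /=; have [r0|r0] := ltP 0 r; last first.
    (* A dummy value for a degenerate ball, so that [choice] yields a total function. *)
    by exists ((0, 0), 0).
  have n0 : 0 < n.+1%:R^-1 :> R by rewrite invr_gt0 ltr0n.
  (* With this constant, rescaling [z] to norm [r / 2] makes [S t] exceed [n.+1]; the surplus of 1
     over [n] is spent on continuity of [S t] at [x']. *)
  have [t [z [t0 tn tz]]] := large (2 * n.+1%:R / r) _ n0.
  have z0 : z != 0.
    apply: contraTneq tz => ->; rewrite (prop_linear0 (linS _ t0)).
    by rewrite rnorm0 mulr0 ltxx.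
  have nz : 0 < rnorm z by rewrite rnorm_gt0.
  have r20 : 0 <= r / 2 by rewrite divr_ge0// ltW.
  pose w := (r / 2 / rnorm z)%:C *: z.
  have wr : rnorm w = r / 2 by rewrite rnorm_scale_to.
  have wS : n.+1%:R <= rnorm (S t w).
    rewrite (prop_linearZ _ _ (linS _ t0)) rnormZ.
    rewrite ger0_norm ?(divr_ge0 r20 (rnorm_ge0 z))//.
    have -> : n.+1%:R = r / 2 / rnorm z * (2 * n.+1%:R / r * rnorm z).
      by field; rewrite !lt0r_neq0.
    by rewrite ler_pM2l ?ltW// divr_gt0// divr_gt0.
  have [x' [xx' xS]] : exists x', rnorm (x - x') = r / 2 /\
      n.+1%:R <= rnorm (S t x').
    have [h|h] := two_sided_large x w (linS _ t0).
      exists (x + w); split; last exact: le_trans h.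
      by rewrite opprD addrA subrr sub0r rnormN.
    exists (x - w); split; last exact: le_trans h.
    by rewrite opprB addrC subrK.
  have [r' r'0 cr'] := continuous_rnorm x' (contS _ t0) ltr01.
  (* The three bounds keep the new ball inside the old one, keep it within the continuity radius,
     and make the radii tend to 0. *)
  exists ((x', minr (minr (r / 2) (r' / 2)) n.+1%:R^-1), t) => _.
  split=> //=; first by rewrite !lt_min n0 !divr_gt0.
    by rewrite ge_min lexx orbT.
  move=> y; rewrite !le_min => /andP[/andP[y1 y2] _]; split.
    by rewrite (le_trans (rnorm_distD x' _ _))// xx'; lra.
  have /cr' Sy : rnorm (x' - y) < r' by lra.
  have := rnorm_distD (S t y) (S t x') 0.
  move: xS; rewrite -natr1 !subr0; move: Sy; lra.
have [g gP] := choice step.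
pose fix b n : H * R := if n is m.+1 then (g (m, b m)).1 else (0, 1).
pose t n := (g (n, b n)).2.
have b0 n : 0 < (b n).2.
  elim: n => [|n IH]; first exact: ltr01.
  by have [] := gP (n, b n) IH.
have bP n : P n (b n) (b n.+1) (t n) by exact: gP (n, b n) (b0 n).
have nested m n y : (m <= n)%N ->
    rnorm ((b n).1 - y) <= (b n).2 -> rnorm ((b m).1 - y) <= (b m).2.
  move=> /subnK <-; elim: (n - m)%N => [//|k IH] /= h.
  by apply: IH; have [_ _ _ _ /(_ _ h)[]] := bP (k + m)%N.
have near_center n k : (n <= k)%N -> rnorm ((b n).1 - (b k).1) <= (b n).2.
  by move=> nk; apply: (nested _ _ _ nk); rewrite subrr rnorm0 ltW.
have : cvg ((fun n => (b n).1) @ \oo).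
  apply: rnorm_cauchy_cvg => e e0.
  have [N Ne] : exists N, 2 * N.+1%:R^-1 < e.
    exists (truncn (2 / e)); rewrite ltr_pdivrMr ?ltr0n// mulrC.
    by rewrite -ltr_pdivrMr// truncnS_gt.
  (* Later centres lie in the ball of index [N.+1], whose radius is at most [N.+1%:R^-1]. *)
  exists N.+1 => m n Nm Nn; apply: le_lt_trans Ne.
  rewrite (le_trans (rnorm_distD (b N.+1).1 _ _))//.
  have [_ bN _ _ _] := bP N.
  have := near_center _ _ Nm; have := near_center _ _ Nn.
  rewrite (rnorm_distC (b m).1).
  by move: bN; set a := _^-1; lra.
move=> /cvg_ex[x /= bx].
have xb n : rnorm ((b n).1 - x) <= (b n).2.
  apply: (@ler_cvg_to nat \oo _ R (fun k => rnorm ((b n).1 - (b k).1))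
    (fun=> (b n).2)); last by exists n => // k; exact: near_center.
    by apply: cvg_rnorm; apply: cvgB => //; exact: cvg_cst.
  exact: cvg_cst.
have /cvg_rnormP/(_ _ ltr01)/near_0rightP[d d0 hd] := cvgS x.
(* For this [n], [t n < d] puts [S (t n) x] within 1 of [x], although its norm is at least
   [n > 1 + rnorm x]. *)
pose n := (truncn (d^-1 + (1 + rnorm x))).+1.
have nd : d^-1 + (1 + rnorm x) < n%:R by rewrite truncnS_gt.
have [_ _ tn0 tn /(_ _ (xb n.+1))[_ xn]] := bP n.
have dx : 0 < d^-1 by rewrite invr_gt0.
have x0 := rnorm_ge0 x.
have /(hd _ tn0) : t n < d.
  apply: lt_le_trans tn _; rewrite -[leRHS]invrK lef_pV2 ?posrE ?ltr0n//.
  by rewrite -natr1; lra.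
have := rnorm_distD x (S (t n) x) 0; rewrite !subr0 (rnorm_distC _ x).
by move: xn nd; lra.
Qed.

End uniform_boundedness.

(** Allow a slope [e > 0] and take the supremum of the times [s <= t] with [g s <= g 0 + e * s]. The
    second hypothesis puts the supremum in this set; the first moves past it unless it equals
    [t]. *)
Lemma right_dini_nonincreasing {R : realType} (g : R -> R) :
  (forall t e, 0 <= t -> 0 < e -> exists2 d, 0 < d &
    forall h, 0 < h -> h < d -> g (t + h) <= g t + e * h) ->
  (forall t e, 0 < t -> 0 < e -> exists2 d, 0 < d &
    forall s, 0 <= s -> t - d < s -> s < t -> g t <= g s + e) ->
  forall t, 0 <= t -> g t <= g 0.
Proof.
move=> right left t t0; apply/ler_addgt0Pr => e' e'0.
have t10 : 0 < t + 1 by rewrite ltr_wpDl.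
(* This gives [e * t <= e']; the summand 1 covers [t = 0]. *)
pose e := e' / (t + 1).
have e0 : 0 < e by rewrite divr_gt0.
have et : e * t <= e' by rewrite mulrAC ler_pdivrMr//; nra.
suff : g t <= g 0 + e * t by move=> /le_trans; apply; rewrite lerD2l.
pose E := [set s | [/\ 0 <= s, s <= t & g s <= g 0 + e * s]].
have E0 : has_sup E.
  split; first by exists 0; split=> //; rewrite mulr0 addr0.
  by exists t => s [].
have supE s : E s -> s <= sup E by apply: (sup_ubound E0.2).
have m0 : 0 <= sup E by apply: supE; split=> //; rewrite mulr0 addr0.
have mt : sup E <= t by apply: (sup_le_ub E0.1) => s [].
have gm : g (sup E) <= g 0 + e * sup E.
  have [->|m1] := eqVneq (sup E) 0; first by rewrite mulr0 addr0.
  have {}m0 : 0 < sup E by rewrite lt_neqAle eq_sym m1.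
  apply/ler_addgt0Pr => e1 e10.
  have [d d0 hd] := left _ _ m0 e10.
  have [s Es ms] := sup_adherent d0 E0.
  have [s0 st gs] := Es.
  have := supE _ Es; rewrite le_eqVlt => /predU1P[<-|sm].
    by rewrite (le_trans gs)// lerDl ltW.
  rewrite (le_trans (hd _ s0 ms sm))// lerD2r (le_trans gs)// lerD2l.
  by rewrite ler_pM2l// ltW.
have [->//|tm] := eqVneq t (sup E).
have {}mt : sup E < t by rewrite lt_neqAle eq_sym tm.
have [d d0 hd] := right _ _ m0 e0.
pose h := minr (d / 2) (t - sup E).
have h0 : 0 < h by rewrite lt_min subr_gt0 mt divr_gt0.
have hle : h < d by rewrite gt_min; apply/orP; left; lra.
have ht : h <= t - sup E by rewrite ge_min lexx orbT.
have : E (sup E + h).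
  split; [by rewrite addr_ge0// ltW|by lra|].
  by rewrite (le_trans (hd _ h0 hle))// mulrDr addrA lerD2r.
by move=> /supE; rewrite gerDl leNgt h0.
Qed.

(** * Distance to a convex set along the semigroup *)

Section invariance.
Context {R : realType} {H : hilbertType R}.
Variables (A : operator H) (S : R -> H -> H).
Hypotheses (S_C0 : C0_semigroup S) (S_gen : generates (op_opp A) S).
Implicit Types (x y z : H) (C : set H) (P : H -> H).
Local Open Scope complex_scope.

Let S_lin t (t0 : 0 < t) : linear (S t) := C0_linear S_C0 t0.
Let S_cont t (t0 : 0 < t) : continuous (S t) := C0_continuous S_C0 t0.

Lemma semigroupDE s t x : 0 < s -> 0 < t -> S (s + t) x = S s (S t x).
Proof. by move=> s0 t0; rewrite (C0_add S_C0). Qed.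

Lemma diff_quotientK x t : 0 < t -> S t x = x + t%:C *: diff_quotient S x t.
Proof.
move=> t0; rewrite scalerA -rmorphM mulfV ?lt0r_neq0// scale1r addrC.
by rewrite subrK.
Qed.

(** [S t] is continuous and commutes with [S h], so it carries the difference quotients of [x] to
    those of [S t x]. *)
Lemma semigroup_dom t x : 0 < t -> op_dom A x -> op_dom A (S t x).
Proof.
move=> t0 Dx; have [domE cvgA] := S_gen.
change (op_dom (op_opp A) (S t x)); rewrite domE /=.
apply/cvg_ex; exists (S t (- A x)).
have : S t (diff_quotient S x h) @[h --> 0^'+] --> S t (- A x).
  by apply: continuous_cvg; [exact: S_cont|exact: cvgA].
apply: cvg_trans; apply: near_eq_cvg; near=> h.
have h0 : 0 < h by near: h; exact: nbhs_right_gt.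
rewrite /diff_quotient (prop_linearZ _ _ (S_lin t0)).
by rewrite (prop_linearB _ _ (S_lin t0)) -!semigroupDE// (addrC t h).
Unshelve. all: by end_near. Qed.

(** [P y] competes with [P (S h y)]. Expanding the squared distance from [S h y] to [P y] gives
    exactly [rnorm (y - P y) ^+ 2 + h * F h], and [F h] tends to
    [-2 * rdot (A y) (y - P y) <= 0]. *)
Lemma semigroup_right_dini C P y (e : R) : is_projection C P ->
  op_dom A y -> 0 <= rdot (A y) (y - P y) -> 0 < e ->
  exists2 d : R, 0 < d & forall h, 0 < h -> h < d ->
    rnorm (S h y - P (S h y)) ^+ 2 <= rnorm (y - P y) ^+ 2 + e * h.
Proof.
move=> PC Dy Ay e0; have cvgA := S_gen.2 _ Dy.
pose F h := 2 * rdot (diff_quotient S y h) (y - P y) +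
  h * rnorm (diff_quotient S y h) ^+ 2.
have /cvgr_lt/(_ e) : F h @[h --> 0^'+] -->
    2 * rdot (- A y) (y - P y) + 0 * rnorm (- A y) ^+ 2.
  apply: cvgD; apply: cvgM.
  - exact: cvg_cst.
  - by apply: cvg_rdot => //; exact: cvg_cst.
  - exact: cvg_at_right_filter.
  - by rewrite expr2; apply: cvgM; exact: cvg_rnorm.
rewrite mul0r addr0 rdotNl => /(_ _)/near_0rightP[|d d0 hd]; first by lra.
exists d => // h h0 /(hd _ h0) Fh.
have -> : rnorm (y - P y) ^+ 2 + e * h =
    rnorm (y - P y) ^+ 2 + F h * h + (e - F h) * h by ring.
apply: ler_wpDr; first by rewrite mulr_ge0 ?subr_ge0 ?ltW.
have -> : rnorm (y - P y) ^+ 2 + F h * h = rnorm (S h y - P y) ^+ 2.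
  rewrite (diff_quotientK _ h0) addrAC [RHS]rnorm_sqrD rdotZr rnormZ exprMn.
  by rewrite real_normK ?num_real// rdotC /F; ring.
rewrite (@ler_pXn2r _ 2)// ?nnegrE ?rnorm_ge0//.
by rewrite -lecR -!rnormE; apply: (PC _).2; apply: (PC y).1.
Qed.

(** A bound on [S s] uniform in [s] near [t] is needed. Contractivity is deduced from this lemma and
    cannot be used yet, so [S s] is factored through the fixed operator [S (t - dl)] and a short
    time below [d0]. *)
Lemma semigroup_left_cvg x t (e : R) : 0 < t -> 0 < e ->
  exists2 d : R, 0 < d & forall s, 0 < s -> t - d < s -> s < t ->
    rnorm (S t x - S s x) < e.
Proof.
move=> t0 e0; have [M [d0 [d00 SM]]] := semigroup_locally_bounded S_C0.
pose dl := minr d0 t / 2.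
have dl0 : 0 < dl by rewrite divr_gt0// lt_min d00.
have dlt : dl < t.
  by rewrite ltr_pdivrMr// gt_min; apply/orP; right; lra.
have dld : dl < d0.
  by rewrite ltr_pdivrMr// gt_min; apply/orP; left; lra.
have c0 : 0 < t - dl by rewrite subr_gt0.
have [K K0 SK] := continuous_linear_rnorm_bounded (S_lin c0) (S_cont c0).
(* The sign of [M] is unknown, hence the absolute value; adding 1 keeps the divisor positive. *)
have KM : 0 < K * `|M| + 1 by rewrite ltr_wpDl ?mulr_ge0.
have e1 : 0 < e / (K * `|M| + 1) by rewrite divr_gt0.
have /cvg_rnormP/(_ _ e1)/near_0rightP[d d1 hd] := @C0_cvg _ _ _ S_C0 x.
exists (minr d dl) => [|s s0]; first by rewrite lt_min d1.
rewrite ltrBlDr -ltrBlDl lt_min => /andP[sd sdl] st.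
have h0 : 0 < t - s by rewrite subr_gt0.
have r0 : 0 < s - (t - dl) by lra.
have rd : s - (t - dl) < d0 by lra.
have -> : S t x - S s x = S (t - dl) (S (s - (t - dl)) (S (t - s) x - x)).
  rewrite (prop_linearB _ _ (S_lin r0)) (prop_linearB _ _ (S_lin c0)).
  rewrite -!semigroupDE//; last by rewrite addr_gt0.
  by congr (S _ _ - S _ _); ring.
have {hd} := hd _ h0 sd; rewrite rnorm_distC; set n := rnorm _ => hn.
have n0 : 0 <= n := rnorm_ge0 _.
apply: (@le_lt_trans _ _ ((K * `|M| + 1) * n)); last by rewrite mulrC -ltr_pdivlMr.
rewrite (le_trans (SK _))// (@le_trans _ _ (K * (`|M| * n)))//.
  rewrite ler_wpM2l// (le_trans (SM _ r0 rd _))//.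
  by rewrite ler_wpM2r// ler_norm.
by rewrite mulrA ler_wpM2r// lerDl.
Qed.

(** The orbit stays in the domain, so the Dini estimate holds at each of its points and the
    monotonicity criterion applies to the squared distance. *)
Lemma semigroup_dist_le_dom C P : is_projection C P ->
  (forall y, op_dom A y -> 0 <= rdot (A y) (y - P y)) ->
  forall x t, op_dom A x -> 0 < t ->
    rnorm (S t x - P (S t x)) <= rnorm (x - P x).
Proof.
move=> PC Apos x t Dx t0.
(* [S 0] is unconstrained, so the orbit is completed by [x] at time 0. *)
pose u s := if 0 < s then S s x else x.
pose dist y := rnorm (y - P y).
have uE s : 0 < s -> u s = S s x by rewrite /u => ->.
have u0 : u 0 = x by rewrite /u ltxx.
have Du s : op_dom A (u s) by rewrite /u; case: ifPn => // /semigroup_dom; exact.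
have uS s h : 0 <= s -> 0 < h -> u (s + h) = S h (u s).
  rewrite le_eqVlt => /predU1P[<- h0|s0 h0]; first by rewrite add0r u0 uE.
  by rewrite !uE ?addr_gt0// addrC semigroupDE.
have : dist (u t) ^+ 2 <= dist (u 0) ^+ 2.
  apply: (@right_dini_nonincreasing _ (fun s => dist (u s) ^+ 2)); last exact: ltW.
    move=> s e s0 e0.
    have [d d0 hd] := semigroup_right_dini PC (Du s) (Apos _ (Du s)) e0.
    by exists d => // h h0 /(hd _ h0); rewrite uS.
  move=> s e s0 e0; pose D := dist (u s).
  have D0 : 0 <= D := rnorm_ge0 _.
  have e1 : 0 < e / (2 * D + 1) by rewrite divr_gt0// ltr_wpDl ?mulr_ge0.
  have [d d0 hd] := semigroup_left_cvg x s0 e1.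
  (* The minimum with [s] forces [r > 0], where [u r] is [S r x]. *)
  exists (minr d s) => [|r _]; first by rewrite lt_min d0.
  rewrite ltrBlDr -ltrBlDl lt_min ltrBlDr -ltrBlDl => /andP[dr r0] rs.
  have {}r0 : 0 < r by lra.
  have {}dr : s - d < r by lra.
  have := hd _ r0 dr rs; rewrite -!uE// ltr_pdivlMr ?ltr_wpDl ?mulr_ge0//.
  have := projection_dist (u s) (u r) PC; rewrite -/(dist (u r)) -/D.
  have := rnorm_ge0 (u s - u r); have := rnorm_ge0 (u r - P (u r)).
  rewrite -/(dist (u r)) => r1 n0 Dn ne.
  (* [D^2 - d^2 <= 2 D (D - d)], as the difference is [(D - d)^2] *)
  have : D ^+ 2 - dist (u r) ^+ 2 <= 2 * D * rnorm (u s - u r).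
    apply: (@le_trans _ _ (2 * D * (D - dist (u r)))).
      by rewrite -subr_ge0 (_ : _ - _ = (D - dist (u r)) ^+ 2) ?sqr_ge0//; ring.
    by rewrite ler_wpM2l ?mulr_ge0//; lra.
  by rewrite -/D; nra.
rewrite (@ler_pXn2r _ 2)// ?nnegrE ?rnorm_ge0// uE// u0.
exact.
Qed.

Hypothesis A_maccr : m_accretive A.

Lemma semigroup_dist_le C P : is_projection C P ->
  (forall y, op_dom A y -> 0 <= rdot (A y) (y - P y)) ->
  forall x t, 0 < t -> rnorm (S t x - P (S t x)) <= rnorm (x - P x).
Proof.
move=> PC Apos x t t0; apply/ler_addgt0Pr => e e0.
have [K K0 SK] := continuous_linear_rnorm_bounded (S_lin t0) (S_cont t0).
have K1 : 0 < K + 1 by rewrite ltr_wpDl.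
(* Replacing [x] by [y] costs [rnorm (x - y)] before applying [S t] and at most [K] times as much
   after. *)
have e1 : 0 < e / (K + 1) by rewrite divr_gt0.
have [y Dy xy] := m_accretive_dense A_maccr x e1.
have := semigroup_dist_le_dom PC Apos Dy t0.
have := projection_dist (S t x) (S t y) PC.
have := projection_dist y x PC.
have := SK (x - y); rewrite (prop_linearB _ _ (S_lin t0)) (rnorm_distC y x).
by move: xy; rewrite ltr_pdivlMr//; lra.
Qed.

Lemma semigroup_contraction x t : 0 < t -> rnorm (S t x) <= rnorm x.
Proof.
move=> t0; have P0 : is_projection [set (0 : H)] (fun=> 0).
  by move=> y; split=> // _ ->.
have := semigroup_dist_le P0 _ x t0; rewrite !subr0; apply=> y Dy.
by rewrite subr0; exact: A_maccr.1.
Qed.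

Theorem semigroup_invariance C P : convex_set C -> is_projection C P ->
  (forall t, 0 < t -> S t @` C `<=` C) <->
  (forall x, op_dom A x -> 0 <= rdot (A x) (x - P x)).
Proof.
move=> cC PC; split=> [SC x Dx|Apos t t0 _ [x Cx <-]]; last first.
  have Sx : rnorm (S t x - P (S t x)) = 0.
    apply/eqP; rewrite eq_le rnorm_ge0 andbT.
    rewrite (le_trans (semigroup_dist_le PC Apos x t0))// -lecR -rnormE.
    by rewrite (le_trans ((PC x).2 _ Cx))// subrr normr0.
  by move/rnorm_eq0/eqP: Sx; rewrite subr_eq0 => /eqP ->; exact: (PC _).1.
have cvgA : rdot (diff_quotient S x t) (x - P x) @[t --> 0^'+] -->
    rdot (- A x) (x - P x).
  by apply: cvg_rdot; [exact: S_gen.2|exact: cvg_cst].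
suff : rdot (- A x) (x - P x) <= 0 by rewrite rdotNl oppr_le0.
apply: (@ler_cvg_to _ 0^'+ _ R _ (fun=> 0) _ _ cvgA (cvg_cst _)).
near=> t.
have t0 : 0 < t by near: t; exact: nbhs_right_gt.
rewrite rdotZl pmulr_rle0 ?invr_gt0//.
(* Paired with [x - P x], the first term is at most [rnorm (x - P x) ^+ 2] by contractivity and is
   offset by the last; the middle one is nonpositive by the obtuse angle property. *)
have -> : S t x - x = S t (x - P x) + (S t (P x) - P x) - (x - P x).
  rewrite (prop_linearB _ _ (S_lin t0)) addrA subrK opprB addrA.
  by rewrite subrK.
have SPx : C (S t (P x)) by apply: (SC _ t0); exists (P x) => //; exact: (PC x).1.
have := projection_obtuse x cC PC SPx.
rewrite !rdotDl !rdotNl -(sqr_rnorm (x - P x)).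
have := rdot_le (S t (x - P x)) (x - P x).
have := semigroup_contraction (x - P x) t0.
by have := rnorm_ge0 (x - P x); nra.
Unshelve. all: by end_near. Qed.

End invariance.

(** * From sequences in [V] to the inequality on the domain of [A] *)

Lemma limn_esup_EFin {R : realType} (f : nat -> R) (l : R) :
  f k @[k --> \oo] --> l -> limn_esup (fun k => (f k)%:E) = l%:E.
Proof.
move=> fl; have fl' : (f k)%:E @[k --> \oo] --> l%:E.
  by apply: cvg_EFin => //; exact: nearW.
by rewrite is_cvg_limn_esupE; [exact: cvg_lim|apply/cvg_ex; exists l%:E].
Qed.

Theorem lemma9p3 (R : realType) (V H : hilbertType R)
  (a : {bilinear V -> V -> R[i] | *%R & (@conjC R[i] \; *%R)})
  (a_cont : continuous (fun p : V * V => (a p.1 p.2 : R[i]^o)))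
  (a_accr : accretive_form a)
  (j : {linear V -> H}) (j_cont : continuous j) (j_dense : dense (range j))
  (A : operator H) (A_maccr : m_accretive A) (A_assoc : associated a j A)
  (S : R -> H -> H) (S_C0 : C0_semigroup S) (S_gen : generates (op_opp A) S)
  (C : set H) (C_nonempty : C !=set0) (C_closed : closed C)
  (C_convex : convex_set C) (P : H -> H) (P_proj : is_projection C P) :
  [<->
    forall t : R, 0 < t -> S t @` C `<=` C;
    forall u, form_dom a j u -> forall w : nat -> V,
      j (w k) @[k --> \oo] --> P (j u) ->
      cvgn (fun k => complex.Re (a u (u - w k))) /\
      0 <= limn (fun k => complex.Re (a u (u - w k)));
    forall u, form_dom a j u -> exists w : nat -> V,
      [/\ forall k, form_dom a j (w k),
          j (w k) @[k --> \oo] --> P (j u) &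
          (0 <= limn_esup (fun k => (complex.Re (a u (u - w k)))%:E))%E];
    forall u, form_dom a j u -> exists w : nat -> V,
      j (w k) @[k --> \oo] --> P (j u) /\
      (0 <= limn_esup (fun k => (complex.Re (a u (u - w k)))%:E))%E].
Proof.
have [domA assocA] := A_assoc.
have formE u v : form_dom a j u ->
    complex.Re (a u (u - v)) = rdot (A (j u)) (j u - j v).
  by move=> Du; rewrite assocA// linearB.
(* Along every admissible sequence the limit exists and has the same value, so limit and upper
   limit, and every sequence and some sequence, impose one condition. *)
have form_cvg u (w : nat -> V) : form_dom a j u ->
    j (w k) @[k --> \oo] --> P (j u) ->
    complex.Re (a u (u - w k)) @[k --> \oo] -->
    rdot (A (j u)) (j u - P (j u)).
  move=> Du wP; under eq_fun do rewrite formE//.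
  apply: cvg_rdot; first exact: cvg_cst.
  by apply: cvgB => //; exact: cvg_cst.
have invP := semigroup_invariance S_C0 S_gen A_maccr C_convex P_proj.
tfae.
- move=> /invP Apos u Du w wP; have cw := form_cvg _ _ Du wP.
  split; first by apply/cvg_ex; eexists; exact: cw.
  rewrite (cvg_lim _ cw)//; apply: Apos.
  by rewrite domA; exists u.
- move=> pos u Du.
  (* The domain of [A] is dense and is the image of the form domain under [j], so the approximants
     of [P (j u)] can be lifted into the form domain. *)
  have /choice[w wP] k : exists w, form_dom a j w /\
      rnorm (P (j u) - j w) < k.+1%:R^-1.
    have k0 : 0 < k.+1%:R^-1 :> R by rewrite invr_gt0 ltr0n.
    have [y] := m_accretive_dense A_maccr (P (j u)) k0.
    by rewrite domA => -[w Dw <-] wk; exists w.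
  have jw : j (w k) @[k --> \oo] --> P (j u).
    apply/cvg_rnormP => e e0.
    near=> k; rewrite (lt_trans (wP k).2)//.
    by near: k; exact: near_infty_natSinv_lt (PosNum e0).
  exists w; split=> // [k|]; first exact: (wP k).1.
  have cw := form_cvg _ _ Du jw.
  rewrite (limn_esup_EFin cw) lee_fin.
  by have [_] := pos _ Du _ jw; rewrite (cvg_lim _ cw).
- by move=> h u /h[w [_ wP wlim]]; exists w.
- move=> h; apply/invP => x; rewrite domA => -[u Du <-].
  have [w [wP]] := h u Du.
  by rewrite (limn_esup_EFin (form_cvg _ _ Du wP)) lee_fin.
Unshelve. all: by end_near. Qed.
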